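(* Let $d\ge 1$ be an integer. There exist orthogonal, diagonal matrices $R_1,\ldots,R_{\omega(d)}\in\mathbb{M}_d$ such that $$ \Delta(X)=\frac{1}{\omega(d)}\sum_{i=1}^{\omega(d)}R_iXR_i^* $$ for every matrix $X\in\mathbb{M}_d$.
   Context: $\mathbb{M}_d$ is the space of complex $d\times d$ matrices. An orthogonal matrix is a real unitary matrix. $\Delta(X)$ is the diagonal part of $X$, i.e. the diagonal matrix with the same diagonal entries as $X$. For a positive integer $d$, $\omega(d)$ is the smallest number of the form $2^m$ ($m\ge 0$ an integer) such that $d\le\omega(d)$. *)

(* Defs.v *)
From HB Require Import structures.
From mathcomp Require Import all_boot all_order all_algebra.
From mathcomp Require Import reals complex.

Set Implicit Arguments.
Unset Strict Implicit.
Unset Printing Implicit Defensive.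

Import Order.TTheory GRing.Theory Num.Theory.
Local Open Scope ring_scope.
Local Open Scope sesquilinear_scope.

Definition diag_part (C : nzRingType) (d : nat) (X : 'M[C]_d) : 'M[C]_d :=
  diag_mx (\row_j X j j).

Definition orthogonalmx (C : numClosedFieldType) (d : nat) : {pred 'M[C]_d} :=
  [pred U | (U \is a realmx) && (U \is unitarymx)].
Arguments orthogonalmx {C d}.

(* up_log 2 d is the least e with d <= 2 ^ e, so this is the least power of 2
   that is at least d, as omega_spec checks. *)
Definition omega (d : nat) : nat := (2 ^ up_log 2 d)%N.

Lemma omega_spec (d : nat) :
  [/\ exists m, omega d = (2 ^ m)%N,
      (d <= omega d)%N
    & forall m, (d <= 2 ^ m)%N -> (omega d <= 2 ^ m)%N].
Proof.
split; first by exists (up_log 2 d).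
  exact: up_logP.
by move=> m dm; rewrite leq_exp2l // up_log_min.
Qed.

(* Main.v *)
(* The i-th signature matrix carries row i of a Sylvester-Hadamard matrix H of
   order omega(d) on its diagonal, truncated to d entries. Conjugation multiplies
   X j k by H i j * H i k, and summing over i leaves only the diagonal because
   the columns of H are orthogonal. *)
Require Import Defs.
From HB Require Import structures.
From mathcomp Require Import all_boot all_order all_algebra.
From mathcomp Require Import reals complex.

Set Implicit Arguments.
Unset Strict Implicit.
Unset Printing Implicit Defensive.

Import Order.TTheory GRing.Theory Num.Theory.
Local Open Scope ring_scope.
Local Open Scope sesquilinear_scope.

(* Over an integral domain, [x ^+ 2 = 1] means that [x] is [1] or [-1]. *)
Definition hadamard (A : comNzRingType) (n : nat) (H : 'M[A]_n) : Prop :=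
  (forall i j, H i j ^+ 2 = 1) /\ H^T *m H = n%:R%:M.

(** Sylvester's doubling: in the Gram matrix the two off-diagonal blocks are [H^T *m H - H^T *m H],
    while each diagonal block is [H^T *m H] twice. *)
Lemma hadamard_double (A : comNzRingType) (n : nat) (H : 'M[A]_n) :
  hadamard H -> hadamard (block_mx H H H (- H)).
Proof.
case=> H1 HH; split.
  by move=> i j; rewrite !mxE; case: splitP => ? _; rewrite !mxE;
    case: splitP => ? _; rewrite ?mxE ?sqrrN H1.
rewrite tr_block_mx mulmx_block [(- H)^T]linearN /= !(mulmxN, mulNmx) opprK HH subrr.
by rewrite -raddfD -natrD /= scalar_mx_block.
Qed.

Lemma hadamard_exp2 (A : comNzRingType) (m : nat) :
  exists H : 'M[A]_(2 ^ m), hadamard H.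
Proof.
elim: m => [|m [H hadH]].
  exists 1%:M; split; last by rewrite trmx1 mul1mx.
  by move=> i j; rewrite !ord1 mxE eqxx expr1n.
rewrite expnS mul2n -addnn.
by exists (block_mx H H H (- H)); apply: hadamard_double.
Qed.

Lemma sqr1_real (C : numDomainType) (x : C) : x ^+ 2 = 1 -> x \is Num.real.
Proof.
by move/eqP; rewrite sqrf_eq1 => /orP[] /eqP->; rewrite ?realN real1.
Qed.

(** The entries of [v] are signs, hence fixed by complex conjugation. *)
Lemma conj_diag_mxE (C : numClosedFieldType) (d : nat) (v : 'rV[C]_d)
    (X : 'M[C]_d) (j k : 'I_d) :
  (forall j, v 0 j ^+ 2 = 1) ->
  (diag_mx v *m X *m (diag_mx v) ^t*) j k = v 0 j * v 0 k * X j k.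
Proof.
move=> v1; rewrite tr_diag_mx map_diag_mx mul_diag_mx mul_mx_diag !mxE.
by rewrite /= (conj_Creal (sqr1_real (v1 k))) mulrAC.
Qed.

Lemma diag_sign_orthogonal (C : numClosedFieldType) (d : nat) (v : 'rV[C]_d) :
  (forall j, v 0 j ^+ 2 = 1) -> diag_mx v \in orthogonalmx.
Proof.
move=> v1; rewrite inE; apply/andP; split.
  apply/mxOverP => j k; rewrite mxE.
  by case: (j == k); rewrite ?mulr1n ?mulr0n ?real0 ?sqr1_real.
apply/unitarymxP/matrixP => j k.
(* Unitarity is the case [X = 1] of the conjugation formula. *)
rewrite -{1}[diag_mx v]mulmx1 conj_diag_mxE // !mxE.
by case: eqP => [->|_]; rewrite ?mulr0 // mulr1 -expr2 v1.
Qed.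

Theorem lemma4p1 (R : realType) (d : nat) (d_ge1 : (1 <= d)%N) :
  exists U : 'I_(omega d) -> 'M[R[i]]_d,
    (forall i, U i \in orthogonalmx /\ is_diag_mx (U i)) /\
    (forall X : 'M[R[i]]_d,
       diag_part X =
       (omega d)%:R^-1 *: \sum_(i < omega d) (U i *m X *m (U i) ^t*)).
Proof.
have [_ le_d_omega _] := omega_spec d.
have [H [H1 HH]] : exists H : 'M[R[i]]_(omega d), hadamard H.
  exact: hadamard_exp2.
(* [w] selects the first [d] columns of [H], which exist since [d <= omega d]. *)
pose w := widen_ord le_d_omega.
pose v i : 'rV[R[i]]_d := \row_j H i (w j).
have v1 i j : v i 0 j ^+ 2 = 1 by rewrite mxE H1.
exists (fun i => diag_mx (v i)); split=> [i|X].
  by split; [exact: diag_sign_orthogonal | exact: diag_mx_is_diag].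
have omega_neq0 : (omega d)%:R != 0 :> R[i].
  by rewrite pnatr_eq0 -lt0n expn_gt0.
apply/matrixP => j k; rewrite mxE [RHS]mxE summxE mxE.
under eq_bigr => i _ do rewrite conj_diag_mxE // [v i 0 j]mxE [v i 0 k]mxE.
rewrite -mulr_suml.
(* This is entry [(w j, w k)] of [H^T *m H]; [w] preserves the value of an index, so [w j == w k]
   reduces to [j == k]. *)
have -> : \sum_i H i (w j) * H i (w k) = (omega d)%:R *+ (j == k).
  have := congr1 (fun M : 'M_(omega d) => M (w j) (w k)) HH.
  rewrite !mxE => <-.
  by apply: eq_bigr => i _; rewrite mxE.
by case: eqP => [->|_]; rewrite ?mul0r ?mulr0 // mulKf.
Qed.
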